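(* Let $d\ge1$ be an integer, $\mu>-\frac12$, let $0\le m\le n$ be integers, let $p>2n+2\mu+d$, and let $\mathbf k\in\mathbb N_0^d$ with $|\mathbf k|=m$. Then the polynomials $N_{\mathbf k,n}^{(\mu,p)}$ satisfy the three-term recurrence relation $$\begin{aligned}N_{\mathbf k,n+1}^{(\mu,p)}(x,t)=\Big\{&\frac{(p-2\mu-2n-d-1)(p-2\mu-2n-d)}{p-2\mu-m-n-d}\,t-\frac{(p-2\mu-2m-d+1)(p-2\mu-2n-d)}{(p-2\mu-m-n-d)(p-2\mu-2n-d+1)}\Big\}N_{\mathbf k,n}^{(\mu,p)}(x,t)\\&-\frac{(n-m)(p-2\mu-2n-d-1)}{(p-2\mu-m-n-d)(p-2\mu-2n-d+1)}\,N_{\mathbf k,n-1}^{(\mu,p)}(x,t),\end{aligned}$$ where the last term is read as $0$ when $m=n$.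
   Context: Univariate polynomials: $N_n^{(p)}(x)=(-1)^nx^pe^{1/x}\frac{d^n}{dx^n}\left(x^{-p+2n}e^{-1/x}\right)$, a polynomial of degree at most $n$ in $x$. Unit ball: $\mathbb B^d=\{x\in\mathbb R^d:\|x\|\le1\}$, $\mathsf w_\mu(x)=(1-\|x\|^2)^{\mu-1/2}$. $\mathcal V_m^d(\mathbb B^d,\mathsf w_\mu)$ is the space of polynomials of degree at most $m$ in $d$ variables orthogonal to all polynomials of degree less than $m$ with respect to $\mathsf w_\mu(x)\,dx$ on $\mathbb B^d$ (normalized to a probability measure), and $\{P_{\mathbf k}^m:|\mathbf k|=m,\ \mathbf k\in\mathbb N_0^d\}$ is a fixed orthonormal basis of it. With $\alpha=\mu+\frac{d-1}{2}$, for $|\mathbf k|=m\le n$, $$N_{\mathbf k,n}^{(\mu,p)}(x,t)=N_{n-m}^{(p-2\alpha-2m)}(t)\;t^mP_{\mathbf k}^m\!\left(\frac xt\right),$$ where $t^mP_{\mathbf k}^m(x/t)$ is regarded as a homogeneous polynomial of degree $m$ in $(x,t)\in\mathbb R^d\times\mathbb R$. *)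

(* Defs.v *)
From HB Require Import structures.
From mathcomp Require Import all_boot all_order all_algebra.
From mathcomp Require mpoly.
From mathcomp Require Import ring.
From mathcomp Require Import all_classical all_reals all_analysis.
Set Implicit Arguments.
Unset Strict Implicit.
Unset Printing Implicit Defensive.

Import Order.TTheory GRing.Theory Num.Theory.
Import numFieldNormedType.Exports.

Local Open Scope classical_set_scope.
Local Open Scope ring_scope.

Section cons_measure.
Context {R : realType} {n : nat}.
Variable mu : {sigma_finite_measure set (n.-tuple (measurableTypeR R)) -> \bar R}.

Definition cons_tuple (xy : measurableTypeR R * n.-tuple (measurableTypeR R)) :
    n.+1.-tuple (measurableTypeR R) :=
  [the n.+1.-tuple (measurableTypeR R) of xy.1 :: xy.2].

Lemma measurable_cons_tuple : measurable_fun [set: _] cons_tuple.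
Proof. exact: measurable_cons. Qed.

Definition cons_measure : set (n.+1.-tuple (measurableTypeR R)) -> \bar R :=
  pushforward (product_measure1 (@lebesgue_measure R) mu) cons_tuple.

Let cons_measure0 : cons_measure set0 = 0%E.
Proof. by rewrite /cons_measure /pushforward preimage_set0 measure0. Qed.

Let cons_measure_ge0 A : (0 <= cons_measure A)%E.
Proof. by rewrite /cons_measure /pushforward; exact: measure_ge0. Qed.

Let cons_measure_sigma_additive : semi_sigma_additive cons_measure.
Proof.
move=> F mF tF mUF; rewrite /cons_measure /pushforward preimage_bigcup.
have mc A : measurable A -> measurable (cons_tuple @^-1` A).
  by move=> mA; rewrite -[X in measurable X]setTI; exact: measurable_cons_tuple.
apply: measure_semi_sigma_additive.
- by move=> k; exact: mc.
- apply/trivIsetP => /= i j _ _ ij; rewrite -preimage_setI.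
  by move/trivIsetP : tF => /(_ _ _ _ _ ij) ->//; rewrite preimage_set0.
- by rewrite -preimage_bigcup; exact: mc.
Qed.

HB.instance Definition _ := isMeasure.Build _ _ _ cons_measure
  cons_measure0 cons_measure_ge0 cons_measure_sigma_additive.

Let cons_measure_sigma_finite : sigma_finite setT cons_measure.
Proof.
pose uncons (x : n.+1.-tuple (measurableTypeR R)) :=
  (tnth x ord0, [tuple of behead x]).
have consK : cancel cons_tuple uncons.
  by case=> a b; rewrite /uncons/cons_tuple/=; congr pair; exact/val_inj.
have munc : measurable_fun setT uncons.
  apply/measurable_fun_pair => /=; first exact: measurable_tnth.
  exact: measurable_behead.
have /sigma_finiteP[F [FT ndF Foo]] := sigma_finiteT (@lebesgue_measure R).
have /sigma_finiteP[G [GT ndG Goo]] := sigma_finiteT mu.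
exists (fun i => uncons @^-1` (F i `*` G i)).
  rewrite -preimage_bigcup -[LHS](preimage_setT uncons); congr (_ @^-1` _).
  rewrite -setXTT FT GT predeqE => -[x y]; split.
    move=> [/= [i _ Fix] [j _ Gjy]]; exists (maxn i j) => //; split.
    - by move: x Fix; exact/subsetPset/ndF/leq_maxl.
    - by move: y Gjy; exact/subsetPset/ndG/leq_maxr.
  by move=> [i _ []/= ? ?]; split; exists i.
move=> i; have [mF Fi] := Foo i; have [mG Gi] := Goo i; split.
  by rewrite -[X in measurable X]setTI; apply: munc => //; exact: measurableX.
rewrite /cons_measure /pushforward -comp_preimage.
rewrite (_ : uncons \o cons_tuple = id) ?preimage_id; last exact/funext.
by rewrite product_measure1E// lte_mul_pinfty// ge0_fin_numE.
Qed.

HB.instance Definition _ := @Measure_isSigmaFinite.Build _ _ _ cons_measure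
  cons_measure_sigma_finite.

End cons_measure.

(* Lebesgue measure on R^d, as an iterated product measure. *)
Fixpoint lebesgue_tuple (R : realType) (d : nat) :
    {sigma_finite_measure set (d.-tuple (measurableTypeR R)) -> \bar R} :=
  if d is d'.+1 then cons_measure (lebesgue_tuple R d')
  else \d_([tuple] : 0.-tuple (measurableTypeR R)).

(* The notations of mpoly clash with those of MathComp-Analysis: [mpoly d R]
   and [multinom d] are written for {mpoly R[d]} and 'X_{1..d}. *)
Export -(notations) mpoly.

Section ball.
Context {R : realType} {d : nat}.
Implicit Types (x : d.-tuple R) (f g P Q : mpoly d R).

(* Euclidean norm; the library's norm on 'rV[R]_d is the sup norm. *)
Definition sqnorm2 x : R := \sum_(i < d) tnth x i ^+ 2.
Definition norm2 x : R := Num.sqrt (sqnorm2 x).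

Definition unit_ball : set (d.-tuple R) := [set x | norm2 x <= 1].

Definition ball_weight (mu : R) x : R := (1 - norm2 x ^+ 2) `^ (mu - 2^-1).

Definition ball_integral (mu : R) (h : d.-tuple R -> R) : R :=
  \int[lebesgue_tuple R d]_(x in unit_ball) (h x * ball_weight mu x).

(* Inner product for the normalized (probability) measure. *)
Definition ball_inner (mu : R) f g : R :=
  ball_integral mu (fun x => meval (tnth x) f * meval (tnth x) g)
  / ball_integral mu (fun=> 1).

(* msize is 1 + the total degree, and 0 for the zero polynomial. *)
Definition ball_orthopoly (mu : R) (m : nat) P : Prop :=
  (msize P <= m.+1)%N /\
  forall Q, (msize Q <= m)%N -> ball_inner mu P Q = 0.

(* Only the values P k with |k| = m matter: (P k)_{|k| = m} is an orthonormal
   basis of the space of orthogonal polynomials of degree m. *)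
Definition ball_onb (mu : R) (m : nat) (P : multinom d -> mpoly d R) : Prop :=
  [/\ forall k, mdeg k = m -> ball_orthopoly mu m (P k),
      forall k l, mdeg k = m -> mdeg l = m ->
        ball_inner mu (P k) (P l) = (k == l)%:R
    & forall Q, ball_orthopoly mu m Q ->
        exists c : multinom d -> R,
          Q = \sum_(k : bmultinom d m.+1 | mdeg k == m) c k *: P k].

(* t ^ m P(x / t) as a polynomial in (x, t), for deg P <= m. *)
Definition homogenize (m : nat) P x (t : R) : R :=
  \sum_(k <- msupp P)
    mcoeff k P * (\prod_(i < d) tnth x i ^+ k i) * t ^+ (m - mdeg k).

Lemma homogenizeE m P x t : (msize P <= m.+1)%N -> t != 0 ->
  homogenize m P x t = t ^+ m * meval (fun i => tnth x i / t) P.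
Proof.
move=> Pm t0; rewrite /homogenize mevalE mulr_sumr big_seq [RHS]big_seq.
apply: eq_bigr => k /msize_mdeg_lt km.
have {}km : (mdeg k <= m)%N by rewrite -ltnS (leq_trans km).
rewrite mulrCA -mulrA; congr *%R.
have -> : \prod_(i < d) (tnth x i / t) ^+ k i =
    (\prod_(i < d) tnth x i ^+ k i) / t ^+ mdeg k.
  under eq_bigr do rewrite expr_div_n.
  rewrite big_split/=; congr *%R.
  by rewrite prodfV prodrXr mdegE.
rewrite -[X in _ = t ^+ X * _](subnK km) exprD; move: (t ^+ mdeg k) (expf_neq0 (mdeg k) t0) => u u0.
by rewrite mulrC; field.
Qed.

End ball.

Section univariate.
Context {R : realType}.

Definition rodriguesN (n : nat) (p x : R) : R :=
  (-1) ^+ n * x `^ p * expR x^-1 *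
  derive1n n (fun y => y `^ (2 * n%:R - p) * expR (- y^-1)) x.

(* The real powers in rodriguesN are meaningful for x > 0 only; univN is the
   polynomial that coincides with rodriguesN there. *)
Definition univN (n : nat) (p : R) : {poly R} :=
  xget 0 [set q : {poly R} | (size q <= n.+1)%N /\
                             forall x, 0 < x -> q.[x] = rodriguesN n p x].

End univariate.

Definition coneN (R : realType) (d : nat) (mu p : R)
    (P : multinom d -> mpoly d R) (k : multinom d) (n : nat)
    (x : d.-tuple R) (t : R) : R :=
  let m := mdeg k in
  let alpha := mu + (d%:R - 1) / 2 in
  (univN (n - m) (p - 2 * alpha - 2 * m%:R)).[t] * homogenize m (P k) x t.

(* Main.v *)
(* Repeated differentiation gives
     d^n/dy^n (y^s e^(-1/y)) = y^(s-2n) e^(-1/y) 2F0(-n, s-n+1; -; -y),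
   so the N_n^(q) are, up to sign, the Bessel polynomials 2F0(-n, n-q+1; -; -X),
   for which the recurrence is a comparison of coefficients.  N_(k,n) is the
   univariate polynomial of degree n - m and parameter p - 2 alpha - 2m times a
   factor that does not depend on n; the bound on p keeps the denominators
   positive. *)
Require Import Defs.
From HB Require Import structures.
From mathcomp Require Import all_boot all_order all_algebra.
From mathcomp Require mpoly.
From mathcomp Require Import ring lra.
From mathcomp Require Import all_classical all_reals all_analysis.
Import -(notations) mpoly.
Import Order.TTheory GRing.Theory Num.Theory.
Local Open Scope ring_scope.

Section rising_factorial.
Context {K : comNzRingType}.
Implicit Types a : K.

Definition rising a (k : nat) : K := \prod_(i < k) (a + i%:R).

Lemma rising0 a : rising a 0 = 1.
Proof. by rewrite /rising big_ord0. Qed.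

Lemma risingS a k : rising a k.+1 = rising a k * (a + k%:R).
Proof. by rewrite /rising big_ord_recr. Qed.

Lemma risingSl a k : rising a k.+1 = a * rising (a + 1) k.
Proof.
rewrite /rising big_ord_recl addr0; congr (_ * _).
by apply: eq_bigr => i _; rewrite -addrA nat1r.
Qed.

(** The subtraction is in [K], not truncated, so that [ring] can use the relation; for [k > n] both
    binomials vanish. *)
Lemma natr_mul_bin_left n k :
  k.+1%:R * 'C(n, k.+1)%:R = (n%:R - k%:R) * 'C(n, k)%:R :> K.
Proof.
have [nk|kn] := ltnP n k; first by rewrite !bin_small ?mulr0// ltnW.
by rewrite -natrB// -!natrM mul_bin_left.
Qed.

End rising_factorial.

(** * Coefficient identities for the Bessel polynomials *)

Section bessel_poly.
Context {K : numFieldType}.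
Implicit Types a s x : K.

(* The terminating hypergeometric series 2F0(-n, a; -; -X). *)
Definition bessel_poly (n : nat) a : {poly K} :=
  \poly_(k < n.+1) ('C(n, k)%:R * rising a k).

Lemma coef_bessel_poly n a k :
  (bessel_poly n a)`_k = 'C(n, k)%:R * rising a k.
Proof. by rewrite coef_poly; case: ltnP => // nk; rewrite bin_small ?mul0r. Qed.

Lemma bessel_poly0 a : bessel_poly 0 a = 1.
Proof.
apply/polyP => -[|k]; rewrite coef_bessel_poly coef1.
  by rewrite rising0 bin0 mulr1.
by rewrite bin0n mul0r.
Qed.

Lemma bessel_poly1 a : bessel_poly 1 a = 1 + a *: 'X.
Proof.
apply/polyP => -[|[|k]]; rewrite coef_bessel_poly coefD coefZ coef1 coefX/=.
- by rewrite rising0 bin0 mulr0 addr0 mulr1.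
- by rewrite risingS rising0 binn addr0; ring.
- by rewrite bin_small// mul0r mulr0 addr0.
Qed.

(** This is one differentiation: the derivative of [y^c e^(-1/y) q(y)] is
    [y^(c-2) e^(-1/y) ((1 + c y) q + y^2 q')], here with [c = s - 2n]. On coefficients it reduces to
    Pascal's rule and [natr_mul_bin_left]. *)
Lemma bessel_polyS n s :
  bessel_poly n.+1 (s - n%:R) =
  (1 + (s - 2 * n%:R) *: 'X) * bessel_poly n (s - n%:R + 1)
  + 'X * ('X * (bessel_poly n (s - n%:R + 1))^`()).
Proof.
apply/polyP => k; rewrite mulrDl mul1r -scalerAl !coefD coefZ !coefXM.
case: k => [|k] /=; first by rewrite !coef_bessel_poly !rising0 !bin0; ring.
rewrite coef_deriv !coef_bessel_poly risingSl risingS.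
have -> : (if k == 0%N then 0 else ('C(n, k.-1.+1)%:R *
   rising (s - n%:R + 1) k.-1.+1) *+ k.-1.+1) =
   k%:R * ('C(n, k)%:R * rising (s - n%:R + 1) k) :> K.
  by rewrite [RHS]mulr_natl; case: k => [|k].
have := @natr_mul_bin_left K n k; rewrite binS natrD.
have -> : k.+1%:R = k%:R + 1 :> K by rewrite -natr1.
move: 'C(n, k.+1)%:R 'C(n, k)%:R (rising _ _) => u v r uv.
apply/eqP; rewrite -subr_eq0; apply/eqP.
transitivity (r * ((n%:R - k%:R) * v - (k%:R + 1) * u)); first by ring.
by rewrite uv subrr mulr0.
Qed.

(** The parameter moves with [n] because [a] stands for [n - q + 1] with [q] fixed. Denominators are
    cleared; at [n = 0] the factor [n%:R] removes the last term. *)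
Lemma bessel_poly_three_term n a :
  (a * (a + n%:R - 1)) *: bessel_poly n.+1 (a + 1) =
  (a + n%:R) *: (((a + n%:R + 1) * (a + n%:R - 1)) *: 'X
                 + (a - n%:R - 1)%:P) * bessel_poly n a
  + (n%:R * (a + n%:R + 1)) *: bessel_poly n.-1 (a - 1).
Proof.
case: n => [|n] /=.
  rewrite bessel_poly1 !bessel_poly0 -mul_polyC -!mul_polyC.
  by rewrite !(polyCD, polyCM, polyCB); ring.
have cE : n.+1%:R = n%:R + 1 :> K by rewrite natr1.
apply/polyP => -[|[|j]].
- rewrite -scalerAl mulrDl -scalerAl mul_polyC.
  rewrite !(coefD, coefZ, coefXM, coef_bessel_poly) !rising0 !bin0/=; ring.
- rewrite -scalerAl mulrDl -scalerAl mul_polyC.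
  rewrite !(coefD, coefZ, coefXM, coef_bessel_poly) !risingS !rising0 !bin1 !bin0/=.
  rewrite -!natr1; ring.
rewrite -scalerAl mulrDl -scalerAl mul_polyC.
rewrite !(coefD, coefZ, coefXM, coef_bessel_poly) /=.
(* Every term of degree [j + 2] is a multiple of [rising (a + 1) j] and, after Pascal's rule, of
   ['C(n, j)]; what remains is a rational identity in [a], [n] and [j]. *)
have -> : rising (a - 1) j.+2 = (a - 1) * (a * rising (a + 1) j).
  by rewrite risingSl subrK risingSl.
have -> : rising a j.+2 = a * (rising (a + 1) j * (a + 1 + j%:R)).
  by rewrite risingSl risingS.
have -> : rising a j.+1 = a * rising (a + 1) j by rewrite risingSl.
have -> : rising (a + 1) j.+2 = rising (a + 1) j * (a + 1 + j%:R) * (a + 2 + j%:R).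
  by rewrite !risingS -natr1; ring.
rewrite !binS !natrD.
have e1 := @natr_mul_bin_left K n j.
have e2 := @natr_mul_bin_left K n j.+1.
have j1 : j.+1%:R != 0 :> K by rewrite pnatr_eq0.
have j2 : j.+2%:R != 0 :> K by rewrite pnatr_eq0.
have {}e1 : 'C(n, j.+1)%:R = (n%:R - j%:R) * 'C(n, j)%:R / j.+1%:R :> K.
  by rewrite -e1 mulrC mulKf.
have {}e2 : 'C(n, j.+2)%:R = (n%:R - j.+1%:R) * 'C(n, j.+1)%:R / j.+2%:R :> K.
  by rewrite -e2 mulrC mulKf.
rewrite e2 e1 cE; move: j1 j2; rewrite -!natr1.
move: (rising _ _) 'C(n, j)%:R n%:R j%:R => r b N J j1 j2.
by field; rewrite j1 j2.
Qed.

End bessel_poly.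

(** * From the Rodrigues formula to the univariate recurrence *)

Section univN.
Context {R : realType}.
Implicit Types q s x : R.

Lemma derive1n_powR_expRV n s x : 0 < x ->
  derive1n n (fun y => y `^ s * expR (- y^-1)) x =
  x `^ (s - 2 * n%:R) * expR (- x^-1) * (bessel_poly n (s - n%:R + 1)).[x].
Proof.
elim: n x => [|n IHn] x x0.
  by rewrite derive1n0 bessel_poly0 hornerC !mulr0 !subr0 mulr1.
set c := s - 2 * n%:R in IHn *; set q := bessel_poly _ _ in IHn *.
pose g y := y `^ c * expR (- y^-1) * q.[y].
(* The induction hypothesis covers positive points only, hence a neighbourhood of [x], which
   suffices for the derivative at [x]. *)
rewrite derive1nS derive1E (near_eq_derive (g := g)); last first.
  by near=> y; apply: IHn; near: y; exact: lt_nbhsr.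
have xN0 : x != 0 by rewrite gt_eqF.
have dV : is_derive x 1 (fun y : R => - y^-1) (x ^- 2).
  apply: is_derive_eq (is_deriveN (is_deriveV xN0 (is_derive_id x 1))) _.
  by rewrite scaleNr opprK /GRing.scale/= mulr1.
have dE : is_derive x 1 (fun y : R => expR (- y^-1)) (expR (- x^-1) * x ^- 2).
  exact: (@is_derive1_comp _ expR (fun y => - y^-1)).
have dg := is_deriveM (is_deriveM (is_derive1_powR c x0) dE) (is_derive_poly q x).
rewrite (_ : g = ((@powR R)^~ c * (fun y => expR (- y^-1)) * horner q)%R) //.
rewrite derive_val (_ : s - n.+1%:R + 1 = s - n%:R); last by rewrite -natr1; ring.
rewrite bessel_polyS -/q -/c /GRing.scale/= !fctE.
have -> : s - 2 * n.+1%:R = c - 2 by rewrite /c -natr1; ring.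
(* All real powers are reduced to [x^(c-2)] times natural powers, so that [field] can treat the
   former as an atom. *)
have -> : x `^ c = x `^ (c - 2) * x ^+ 2.
  by rewrite -powR_mulrn ?ltW// -powRD ?subrK// xN0 implybT.
have -> : x `^ (c - 1) = x `^ (c - 2) * x.
  rewrite -[X in _ = _ * X]powRr1 ?ltW// -powRD ?xN0 ?implybT//.
  by congr powR; ring.
rewrite !(hornerD, hornerM, hornerZ, hornerX, hornerC); field.
Unshelve. all: by end_near. Qed.

(** For [s = 2n - q] the prefactor [x^q e^(1/x)] cancels the power and the exponential in the
    derivative formula, which leaves a polynomial. *)
Lemma univNE n q :
  univN n q = (-1) ^+ n *: bessel_poly n (n%:R - q + 1).
Proof.
pose b := (-1) ^+ n *: bessel_poly n (n%:R - q + 1).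
have b_size : (size b <= n.+1)%N.
  by rewrite (leq_trans (size_scale_leq _ _))// size_poly.
have bE x : 0 < x -> b.[x] = rodriguesN n q x.
  move=> x0; rewrite /rodriguesN derive1n_powR_expRV// hornerZ.
  rewrite (_ : 2 * n%:R - q - 2 * n%:R = - q); last by ring.
  rewrite (_ : 2 * n%:R - q - n%:R + 1 = n%:R - q + 1); last by ring.
  rewrite powRN expRN; field.
  by rewrite gt_eqF ?expR_gt0// gt_eqF ?powR_gt0.
pose agrees := [set r : {poly R} | (size r <= n.+1)%N /\
  forall x, 0 < x -> r.[x] = rodriguesN n q x]%classic.
(* Since [b] is a member, [xget] returns a member and not merely its default 0. Uniqueness follows:
   the two polynomials agree at the [n + 1] points [1, ..., n + 1]. *)
have [u_size uE] : agrees (univN n q) by apply: (@xgetI _ 0 agrees b); split.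
apply/eqP; rewrite -subr_eq0; apply/eqP.
apply: (@roots_geq_poly_eq0 _ _ [seq i.+1%:R | i <- iota 0 n.+1]).
- apply/allP => _ /mapP[i _ ->].
  by rewrite rootE hornerD hornerN uE ?bE ?subrr ?ltr0n.
- by rewrite map_inj_uniq ?iota_uniq// => i j /eqP; rewrite eqr_nat => /eqP[].
rewrite size_map size_iota (leq_trans (size_polyD _ _))// geq_max u_size.
by rewrite size_polyN.
Qed.

Lemma univN_three_term n q x : 2 * n%:R + 1 < q ->
  (univN n.+1 q).[x] =
  ((q - 2 * n%:R - 2) * (q - 2 * n%:R - 1) / (q - n%:R - 1) * x
   - q * (q - 2 * n%:R - 1) / ((q - n%:R - 1) * (q - 2 * n%:R)))
    * (univN n q).[x]
  - n%:R * (q - 2 * n%:R - 2) / ((q - n%:R - 1) * (q - 2 * n%:R))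
      * (univN n.-1 q).[x].
Proof.
move=> nq; have n0 : 0 <= n%:R :> R by [].
have q1 : q - n%:R - 1 != 0 by rewrite gt_eqF//; lra.
have q2 : q - 2 * n%:R != 0 by rewrite gt_eqF//; lra.
rewrite !univNE !hornerZ.
have /(congr1 (horner^~ x)) := bessel_poly_three_term n (n%:R - q + 1).
rewrite -scalerAl !(hornerD, hornerM, hornerZ, hornerX, hornerC).
have -> : n.+1%:R - q + 1 = n%:R - q + 1 + 1 by rewrite -natr1; ring.
set Y := (-1) ^+ n.-1 * _.
(* The factor [n%:R] stays with [Y] because [(-1)^(n.-1) = - (-1)^n] fails at [n = 0]. *)
have nY : n%:R * Y = - (n%:R * (-1) ^+ n * (bessel_poly n.-1 (n%:R - q + 1 - 1)).[x]).
  rewrite {}/Y; case: n {nq n0 q1 q2} => [|n]; first by rewrite !mul0r oppr0.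
  rewrite (_ : n.+1%:R - q + 1 - 1 = n%:R - q + 1) /= ?exprS; first by ring.
  by rewrite -natr1; ring.
rewrite exprS; move: (_.[x]) (_.[x]) (_.[x]) nY => B1 B0 B2 nY E.
(* With [a = n - q + 1], the factors [a] and [a + n - 1] are the negatives of the denominators
   [q - n - 1] and [q - 2n]. *)
have a1 : n%:R - q + 1 != 0 by rewrite lt_eqF//; lra.
have a2 : n%:R - q + 1 + n%:R - 1 != 0 by rewrite lt_eqF//; lra.
rewrite (canRL (mulKf (mulf_neq0 a1 a2)) E).
set D := (q - n%:R - 1) * (q - 2 * n%:R).
have -> : n%:R * (q - 2 * n%:R - 2) / D * Y = (q - 2 * n%:R - 2) / D * (n%:R * Y).
  by ring.
rewrite nY /D; field.
by rewrite q1 q2 a1 a2.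
Qed.

End univN.

(** * Transfer of the recurrence to the cone *)

Theorem theorem3p7 (R : realType) (d : nat) (hd : (1 <= d)%N)
  (mu : R) (hmu : - 2^-1 < mu)
  (m n : nat) (hmn : (m <= n)%N)
  (p : R) (hp : 2 * n%:R + 2 * mu + d%:R < p)
  (P : multinom d -> mpoly d R) (hP : ball_onb mu m P)
  (k : multinom d) (hk : mdeg k = m)
  (x : d.-tuple R) (t : R) :
  coneN mu p P k n.+1 x t =
    ( (p - 2 * mu - 2 * n%:R - d%:R - 1) * (p - 2 * mu - 2 * n%:R - d%:R)
        / (p - 2 * mu - m%:R - n%:R - d%:R) * t
      - (p - 2 * mu - 2 * m%:R - d%:R + 1) * (p - 2 * mu - 2 * n%:R - d%:R)
        / ((p - 2 * mu - m%:R - n%:R - d%:R)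
           * (p - 2 * mu - 2 * n%:R - d%:R + 1)) )
    * coneN mu p P k n x t
    - (if m == n then 0
       else (n%:R - m%:R) * (p - 2 * mu - 2 * n%:R - d%:R - 1)
            / ((p - 2 * mu - m%:R - n%:R - d%:R)
               * (p - 2 * mu - 2 * n%:R - d%:R + 1))
            * coneN mu p P k n.-1 x t).
Proof.
rewrite /coneN hk.
have -> : p - 2 * (mu + (d%:R - 1) / 2) - 2 * m%:R
    = p - 2 * mu - 2 * m%:R - d%:R + 1 by field.
set q := p - 2 * mu - 2 * m%:R - d%:R + 1.
have NE : n%:R = (n - m)%:R + m%:R :> R by rewrite -natrD subnK.
(* In terms of [q] and the degree [n - m], the bound on [p] is exactly this inequality. *)
have qn : 2 * (n - m)%:R + 1 < q by move: hp; rewrite /q NE; lra.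
rewrite subSn// univN_three_term//.
rewrite (_ : (n.-1 - m)%N = (n - m).-1); last by rewrite -!subn1 subnAC.
have -> : p - 2 * mu - 2 * n%:R - d%:R = q - 2 * (n - m)%:R - 1.
  by rewrite /q NE; ring.
have -> : p - 2 * mu - m%:R - n%:R - d%:R = q - (n - m)%:R - 1.
  by rewrite /q NE; ring.
have -> : n%:R - m%:R = (n - m)%:R :> R by rewrite natrB.
have -> : q - 2 * (n - m)%:R - 1 - 1 = q - 2 * (n - m)%:R - 2 by ring.
have -> : q - 2 * (n - m)%:R - 1 + 1 = q - 2 * (n - m)%:R by ring.
(* For [m = n] the coefficient [n - m] vanishes, in accordance with the last term being read as
   0. *)
case: eqP => [<-|_]; last by rewrite mulrBl !mulrA.
by rewrite subnn !mul0r !subr0 mulrA.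
Qed.
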